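(* Let $\mathcal{H}$ be a real Hilbert space, $A:\mathcal{H}\rightrightarrows\mathcal{H}$ a maximally monotone operator, $D:\mathcal{H}\to\mathcal{H}$ an $\eta$-cocoercive operator with $\eta>0$, $B:\mathcal{H}\to\mathcal{H}$ a $\mu$-cocoercive operator with $\mu>0$, and suppose $C=\operatorname{zer}B\neq\emptyset$. Let $(\lambda_n)_{n\ge1}$ and $(\beta_n)_{n\ge1}$ be sequences of positive real numbers, let $x_1\in\mathcal{H}$ and let $(x_n)_{n\ge1}$ be generated by $$x_{n+1}=J_{\lambda_nA}(x_n-\lambda_nDx_n-\lambda_n\beta_nBx_n)\quad\text{for all } n\ge1 .$$ Set $\tau_n=\sum_{k=1}^n\lambda_k$ and $z_n=\frac1{\tau_n}\sum_{k=1}^n\lambda_kx_k$. Assume that: (1) $A+N_C$ is maximally monotone and $\operatorname{zer}(A+D+N_C)\neq\emptyset$; (2) for every $p\in\operatorname{ran}N_C$, $\ \sum_{n\ge1}\lambda_n\beta_n\left[\sup_{u\in C}\varphi_B\left(u,\frac{p}{\beta_n}\right)-\sigma_C\left(\frac{p}{\beta_n}\right)\right]<+\infty$; (3) $(\lambda_n)_{n\ge1}\in\ell^2\setminus\ell^1$; (4) $\limsup_{n\to+\infty}\lambda_n\beta_n<2\mu$. Then the following statements are true: (i) For every $u\in\operatorname{zer}(A+D+N_C)$ the sequence $(\|x_n-u\|)_{n\ge1}$ is convergent and the series $\sum_{n\ge1}\|x_{n+1}-x_n\|^2$, $\sum_{n\ge1}\lambda_n\beta_n\langle Bx_n,x_n-u\rangle$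 and $\sum_{n\ge1}\lambda_n\beta_n\|Bx_n\|^2$ are convergent as well. In particular $\lim_{n\to+\infty}\|x_{n+1}-x_n\|=0$. If, moreover, $\liminf_{n\to+\infty}\lambda_n\beta_n>0$, then $\lim_{n\to+\infty}\langle Bx_n,x_n-u\rangle=\lim_{n\to+\infty}\|Bx_n\|=0$ and every weak cluster point of $(x_n)_{n\ge1}$ lies in $C$. (ii) $(z_n)_{n\ge1}$ converges weakly to an element of $\operatorname{zer}(A+D+N_C)$ as $n\to+\infty$. (iii) If, additionally, $A$ is strongly monotone, then $(x_n)_{n\ge1}$ converges strongly to the unique element of $\operatorname{zer}(A+D+N_C)$ as $n\to+\infty$.
   Context: For a set-valued operator $M:\mathcal{H}\rightrightarrows\mathcal{H}$: $\operatorname{Gr}M=\{(x,u):u\in Mx\}$, $\operatorname{ran}M=\{u:\exists x,\ u\in Mx\}$, $\operatorname{zer}M=\{x:0\in Mx\}$, and $J_M=(\mathrm{Id}+M)^{-1}$ is the resolvent (single-valued and everywhere defined when $M$ is maximally monotone). $M$ is monotone if $\langle x-y,u-v\rangle\ge0$ for all $(x,u),(y,v)\in\operatorname{Gr}M$; maximally monotone if its graph has no proper monotone extension; $\gamma$-strongly monotone ($\gamma>0$) if $\langle x-y,u-v\rangle\ge\gamma\|x-y\|^2$ for all $(x,u),(y,v)\in\operatorname{Gr}M$, and strongly monotone if this holds for some $\gamma>0$. A single-valued $M:\mathcal{H}\to\mathcal{H}$ is $\gamma$-cocoercive if $\langle x-y,Mx-My\rangle\ge\gamma\|Mx-My\|^2$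 for all $x,y\in\mathcal{H}$. The normal cone of $C$ is $N_C(x)=\{u:\langle u,y-x\rangle\le0\ \forall y\in C\}$ if $x\in C$ and $N_C(x)=\emptyset$ otherwise; the support function is $\sigma_C(u)=\sup_{y\in C}\langle y,u\rangle$. The Fitzpatrick function of a monotone operator $M$ is $\varphi_M(x,u)=\sup_{(y,v)\in\operatorname{Gr}M}\{\langle x,v\rangle+\langle y,u\rangle-\langle y,v\rangle\}$, with values in the extended reals. *)

(* Defs.v *)
(* A real Hilbert space is a [completeNormedModType R] [H]
   with a positive definite symmetric bilinear form [ip : {dot H for idfun}]
   such that [ip x x = `|x| ^+ 2]. *)
From HB Require Import structures.
From mathcomp Require Import all_boot all_order all_algebra.
From mathcomp Require Import all_classical all_reals all_analysis.
Set Implicit Arguments.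
Unset Strict Implicit.
Unset Printing Implicit Defensive.
Import Order.TTheory GRing.Theory Num.Theory.
Import numFieldNormedType.Exports.
Local Open Scope classical_set_scope.
Local Open Scope ring_scope.

Section Operators.
Context {R : realType} {H : completeNormedModType R}.
Implicit Types (M N : H -> set H) (ip : {dot H for @idfun R}).

Definition Gr M : set (H * H) := [set xu | M xu.1 xu.2].
Definition ran M : set H := [set u | exists x, M x u].
Definition zer M : set H := [set x | M x 0].

Definition op_single (f : H -> H) : H -> set H := fun x => [set f x].
Definition op_add M N : H -> set H :=
  fun x => [set u + v | u in M x & v in N x].
Definition op_scale (a : R) M : H -> set H := fun x => [set a *: u | u in M x].
Definition op_inv M : H -> set H := fun u => [set x | M x u].
Definition resolvent M : H -> set H := op_inv (op_add (op_single id) M).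

Definition monotone ip M :=
  forall x u y v, M x u -> M y v -> 0 <= ip (x - y) (u - v).
Definition maximally_monotone ip M :=
  monotone ip M /\
  forall N, monotone ip N -> Gr M `<=` Gr N -> Gr N = Gr M.
Definition strongly_monotone ip M :=
  exists2 gamma : R, 0 < gamma &
    forall x u y v, M x u -> M y v ->
      gamma * `|x - y| ^+ 2 <= ip (x - y) (u - v).
Definition cocoercive ip (gamma : R) (f : H -> H) :=
  forall x y, gamma * `|f x - f y| ^+ 2 <= ip (x - y) (f x - f y).

Definition normal_cone ip (C : set H) : H -> set H :=
  fun x => [set u | C x /\ forall y, C y -> ip u (y - x) <= 0].
Definition support_fun ip (C : set H) (u : H) : \bar R :=
  ereal_sup [set (ip y u)%:E | y in C].
Definition fitzpatrick ip M (x u : H) : \bar R :=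
  ereal_sup [set (ip x yv.2 + ip yv.1 u - ip yv.1 yv.2)%:E | yv in Gr M].

End Operators.

(* The coarsest topology on [H] making every [fun x => ip x v] continuous; by
   the Riesz representation theorem, this is the weak topology of [H]. *)
Definition weak_space {R : realType} {H : completeNormedModType R}
    (ip : {dot H for @idfun R}) : Type :=
  initial_topology (fun x : H => (ip x : {ptws H -> R})).
HB.instance Definition _ (R : realType) (H : completeNormedModType R)
    (ip : {dot H for @idfun R}) :=
  Topological.copy (weak_space ip)
    (initial_topology (fun x : H => (ip x : {ptws H -> R}))).

Section Sequences.
Context {R : realType} {H : completeNormedModType R}.
Implicit Types (ip : {dot H for @idfun R}).

Definition weak_cvg ip (y : nat -> H) (l : H) :=
  (y : nat -> weak_space ip) @ \oo --> (l : weak_space ip).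

(* Topological cluster points: every weak neighbourhood of the point is visited
   infinitely often, so weak limits of subsequences are included. *)
Definition weak_cluster ip (y : nat -> H) : set H :=
  cluster ((y : nat -> weak_space ip) @ \oo).

Lemma weak_cvgP ip (y : nat -> H) (l : H) :
  weak_cvg ip y l <-> forall v, ip (y n) v @[n --> \oo] --> ip l v.
Proof.
pose f (x : H) : {ptws H -> R} := ip x.
have ptwsP := @pointwise_cvgP H R (f \o y @ \oo) (f l) _.
rewrite -[X in _ <-> X]ptwsP (pointwise_cvgE _ setT) {ptwsP}.
split=> [yl|fyl A /=].
  have fc : {for l, continuous (f : weak_space ip -> {ptws H -> R})}.
    exact: initial_continuous.
  by move=> A Af; apply: (yl (f @^-1` A)); exact: fc.
move=> [B [[C oC <-] Cl] BA].
have /fyl/= Cfy : nbhs (f l) C by exact: open_nbhs_nbhs.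
move: Cfy; rewrite !nbhs_filterE; apply: (filterS (F := \oo)) => n Cn.
exact: BA.
Qed.

(* Sequences are indexed from 1: the value at index 0 is never used. *)
Definition cvg_series1 (a : nat -> R) :=
  cvgn (fun n => \sum_(1 <= k < n.+1) a k).

Definition weighted_mean (lambda : nat -> R) (x : nat -> H) (n : nat) : H :=
  (\sum_(1 <= k < n.+1) lambda k)^-1 *: \sum_(1 <= k < n.+1) lambda k *: x k.

End Sequences.

(* Main.v *)
(* Testing the resolvent inclusion against [v \in A u], with [p \in N_C u],
   gives a quasi-Fejer inequality for [|x_n - u|^2]: the penalty term is
   controlled by the cocoercivity of [B] and, [N_C u] being a cone, by the
   Fitzpatrick gap at a multiple of [p].  For [u] in [Z := zer (A + D + N_C)]
   this yields (i) and also the summability of [lambda_n |D x_n - D u|^2].  Hence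
   [D x_n] tends to [D u] in weighted mean, and every [w \in (A + N_C) y]
   satisfies [<z_n - y, w + D u> <= o(1)].  Weak compactness is replaced by
   asymptotic centers: along every filter, a bounded sequence admits a point
   lying in each closed half-space that eventually contains the sequence.
   Maximality of [A + N_C] and cocoercivity of [D] put the asymptotic centers of
   [z_n] in [Z], and Opial's argument shows that they coincide, which is (ii).
   In case (iii), strong monotonicity makes [lambda_n |x_(n+1) - u|^2] summable
   while [lambda_n] is not. *)
Require Import Defs.
From HB Require Import structures.
From mathcomp Require Import all_boot all_order all_algebra.
From mathcomp Require Import all_classical all_reals all_analysis.
From mathcomp Require Import ring lra.
Set Implicit Arguments.
Unset Strict Implicit.
Unset Printing Implicit Defensive.
Import Order.TTheory GRing.Theory Num.Theory.
Import numFieldNormedType.Exports.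
Local Open Scope classical_set_scope.
Local Open Scope ring_scope.

(** * Inner product inequalities and asymptotic centers *)

Section InnerProduct.
Context {R : realType} {H : completeNormedModType R}.
Context (ip : {dot H for @idfun R}).
Context (ip_norm : forall x : H, ip x x = `|x| ^+ 2).
Implicit Types x y u v c : H.

Lemma ipC x y : ip x y = ip y x.
Proof. by have := hermC ip x y; rewrite expr0 mul1r. Qed.

Lemma ipDl u x y : ip (x + y) u = ip x u + ip y u.
Proof. exact: linearDl. Qed.

Lemma ipDr u x y : ip u (x + y) = ip u x + ip u y.
Proof. exact: linearDr. Qed.

Lemma ipNl u x : ip (- x) u = - ip x u.
Proof. exact: linearNl. Qed.

Lemma ipNr u x : ip u (- x) = - ip u x.
Proof. exact: linearNr. Qed.

Lemma ipZl u a x : ip (a *: x) u = a * ip x u.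
Proof. by rewrite linearZl_LR. Qed.

Lemma ipZr u a x : ip u (a *: x) = a * ip u x.
Proof. by rewrite ipC ipZl ipC. Qed.

Definition ipE := (ipDl, ipDr, ipNl, ipNr, ipZl, ipZr).

Lemma ip_sumZl (s : seq nat) (a : nat -> R) (y : nat -> H) v :
  ip (\sum_(k <- s) a k *: y k) v = \sum_(k <- s) a k * ip (y k) v.
Proof.
rewrite linear_sumlz; apply: eq_bigr => k _; exact: ipZl.
Qed.

Lemma normDE x y : `|x + y| ^+ 2 = `|x| ^+ 2 + 2 * ip x y + `|y| ^+ 2.
Proof. by rewrite -!ip_norm !ipE (ipC y x); ring. Qed.

Lemma normBE x y : `|x - y| ^+ 2 = `|x| ^+ 2 - 2 * ip x y + `|y| ^+ 2.
Proof. by rewrite -!ip_norm !ipE (ipC y x); ring. Qed.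

Lemma normB_sqr_le x y : `|x - y| ^+ 2 <= 2 * `|x| ^+ 2 + 2 * `|y| ^+ 2.
Proof. by have := sqr_ge0 `|x + y|; rewrite (normDE x y) normBE; lra. Qed.

Lemma ip_young (t : R) x y : 0 < t ->
  2 * ip x y <= t * `|x| ^+ 2 + t^-1 * `|y| ^+ 2.
Proof.
move=> t0; have := sqr_ge0 `|t *: x - y|.
rewrite normBE normrZ (gtr0_norm t0) exprMn ipZl.
move=> /(mulr_ge0 (ltW (_ : 0 < t^-1))); rewrite invr_gt0 => /(_ t0).
have tV : t^-1 * t = 1 by rewrite mulVf// gt_eqF.
set A := `|x| ^+ 2; set B := `|y| ^+ 2.
have -> : t^-1 * (t ^+ 2 * A - 2 * (t * ip x y) + B) =
  (t^-1 * t) * (t * A) - 2 * (t^-1 * t) * ip x y + t^-1 * B by ring.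
by rewrite tV; lra.
Qed.

(* [c] minimises [limsup_F |z - y|^2] over [y]; the parallelogram law makes
   minimising sequences Cauchy, and moving [c] towards a half-space that
   eventually contains [z] would decrease the limsup. *)
Lemma asymptotic_center {T : Type} (F : set_system T) {FF : ProperFilter F}
    (z : T -> H) (K : R) :
  (\forall t \near F, `|z t| <= K) ->
  exists c, forall v a, (\forall t \near F, ip (z t) v <= a) -> ip c v <= a.
Proof.
move=> zK.
pose S := [set r : R | exists y, \forall t \near F, `|z t - y| ^+ 2 <= r].
have S_ge0 r : S r -> 0 <= r.
  move=> [y yr]; have [t] := filter_ex yr.
  exact: le_trans (sqr_ge0 _).
have hS : has_inf S.
  split; last by exists 0 => r /S_ge0.
  exists (K ^+ 2), 0; near=> t; rewrite subr0 lerXn2r ?nnegrE//.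
    by apply: le_trans (normr_ge0 (z t)) _; near: t.
  by near: t.
pose m := inf S.
have m_ge0 : 0 <= m by apply: lb_le_inf; [case: hS | move=> r /S_ge0].
have m_le r : S r -> m <= r by move=> Sr; apply: ge_inf => //; case: hS.
have par y y' r : (\forall t \near F, `|z t - y| ^+ 2 <= r) ->
    (\forall t \near F, `|z t - y'| ^+ 2 <= r) ->
    `|y - y'| ^+ 2 <= 4 * (r - m).
  move=> yr y'r.
  suff : S (r - `|y - y'| ^+ 2 / 4) by move=> /m_le; lra.
  exists (2^-1 *: (y + y')); near=> t.
  have h1 : `|z t - y| ^+ 2 <= r by near: t.
  have h2 : `|z t - y'| ^+ 2 <= r by near: t.
  move: h1 h2; rewrite -!ip_norm !ipE (ipC y' y) (ipC y (z t)) (ipC y' (z t)).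
  lra.
have pos k : 0 < k.+1%:R^-1 :> R by rewrite invr_gt0.
have approx k : exists y, \forall t \near F, `|z t - y| ^+ 2 <= m + k.+1%:R^-1.
  have [r [y yr] rm] := inf_adherent (pos k) hS.
  by exists y; apply: filterS yr => t /le_trans; apply; exact: ltW.
have [y yP] := choice approx.
have y_close k l : (k <= l)%N -> `|y k - y l| ^+ 2 <= 4 * k.+1%:R^-1.
  move=> kl; have -> : 4 * k.+1%:R^-1 = 4 * (m + k.+1%:R^-1 - m) :> R by ring.
  apply: par => //; apply: filterS (yP l) => t /le_trans; apply.
  by rewrite lerD2l lef_pV2 ?posrE// ler_nat.
have small (e : R) : 0 < e -> \forall k \near \oo, k.+1%:R^-1 < e.
  move=> e0; have /cvgrPdist_lt/(_ e e0) he := @cvg_harmonic R.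
  apply: filterS he => k; rewrite /harmonic /= sub0r normrN gtr0_norm//.
have /cauchy_cvg/cvg_ex[c yc] : cauchy (y k @[k --> \oo]).
  apply: cauchy_exP => e e0.
  have [k _ /(_ k (leqnn k))/= ke] :
      \forall k \near \oo, k.+1%:R^-1 < e ^+ 2 / 4 :> R.
    by apply: small; rewrite divr_gt0// exprn_gt0.
  exists (y k); exists k => // l /= kl.
  rewrite /= -ball_normE /=.
  have := y_close _ _ kl => {}kl.
  rewrite -(@ltr_pXn2r _ 2) ?nnegrE ?normr_ge0 ?(ltW e0)//.
  by apply: le_lt_trans kl _; rewrite mulrC -ltr_pdivlMr.
have center e : 0 < e -> \forall t \near F, `|z t - c| ^+ 2 <= m + e.
  move=> e0.
  (* Young with weight [s] bounds [|z t - c| ^+ 2] by [1 + s] times [|z t - y k| ^+ 2] plus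
     [1 + s^-1] times [|c - y k| ^+ 2]. The choices of [s], [d] and [k] each cost at most [e / 4]
     above [m]. *)
  pose s := e / (4 * (m + 1)).
  have m1 : 0 < m + 1 by lra.
  have s0 : 0 < s by rewrite divr_gt0 // mulr_gt0.
  have sm : s * (m + 1) = e / 4.
    by rewrite /s; field; rewrite gt_eqF.
  have w0 : 0 < 1 + s^-1 by rewrite ltr_wpDl// invr_gt0.
  pose d := e / (4 * (1 + s^-1)).
  have d0 : 0 < d by rewrite divr_gt0 // mulr_gt0.
  have dE : (1 + s^-1) * d = e / 4.
    by rewrite /d; field; rewrite !gt_eqF//=; lra.
  have [k [k1 k2]] : exists k, k.+1%:R^-1 < e / 4 :> R /\ `|c - y k| ^+ 2 < d.
    have : \forall k \near \oo, k.+1%:R^-1 < e / 4 :> R /\ `|c - y k| ^+ 2 < d.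
      near=> k; split; first by near: k; apply: small; rewrite divr_gt0.
      have : `|c - y k| < Num.sqrt d.
        by near: k; move/cvgrPdist_lt : yc; apply; rewrite sqrtr_gt0.
      rewrite -(@ltr_pXn2r _ 2) ?nnegrE ?normr_ge0 ?sqrtr_ge0//.
      by rewrite sqr_sqrtr// ltW.
    by move=> /filter_ex.
  have kle1 : k.+1%:R^-1 <= 1 :> R by rewrite invf_le1 ?ler1n.
  move: k1 kle1 (yP k); move: k.+1%:R^-1 => q k1 q1 yPk.
  apply: filterS yPk => t zy.
  have -> : z t - c = (z t - y k) - (c - y k) by rewrite opprB addrA subrK.
  have yo := ip_young (z t - y k) (- (c - y k)) s0.
  rewrite normrN in yo.
  rewrite normDE normrN.
  have h1 : s * `|z t - y k| ^+ 2 <= s * (m + 1) by rewrite ler_pM2l//; lra.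
  have h2 : (1 + s^-1) * `|c - y k| ^+ 2 <= (1 + s^-1) * d.
    by rewrite ler_pM2l// ltW.
  lra.
exists c => v a za; rewrite leNgt; apply/negP => ac.
pose s := ip c v - a.
have s0 : 0 < s by rewrite subr_gt0.
have v1 : 0 < 1 + `|v| ^+ 2 by rewrite ltr_wpDr// sqr_ge0.
(* Step length towards the half-space: expanding the square gives at most
   [m + r s / 2 - 2 r s + r s], which is below the infimum [m]. The added 1 covers [v = 0]. *)
pose r := s / (1 + `|v| ^+ 2).
have r0 : 0 < r by rewrite divr_gt0.
have rv : r * `|v| ^+ 2 <= s.
  rewrite /r mulrAC ler_pdivrMr// ler_pM2l//. by rewrite lerDr.
have rs : 0 < r * s by rewrite mulr_gt0.
suff /m_le : S (m - r * s / 2) by lra.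
exists (c - r *: v); near=> t.
have h1 : `|z t - c| ^+ 2 <= m + r * s / 2.
  by near: t; apply: center; rewrite divr_gt0.
have h2 : ip (z t) v <= a by near: t.
have -> : z t - (c - r *: v) = (z t - c) + r *: v by rewrite opprB addrA addrAC.
rewrite normDE normrZ (gtr0_norm r0) exprMn !ipE.
have h3 : r * ip (z t) v <= r * (ip c v - s) by rewrite ler_pM2l// /s; lra.
have h4 : r ^+ 2 * `|v| ^+ 2 <= r * s by rewrite expr2 -mulrA ler_pM2l.
have h5 : r * s = r * (ip c v - a) by [].
lra.
Unshelve. all: by end_near.
Qed.

End InnerProduct.

(** * Real sequences: comparison, quasi-Fejer monotonicity, weighted means *)

Section ScalarSequences.
Context {R : realType}.
Implicit Types a b e f u v lambda : nat -> R.

Lemma cvg_series1E a : cvg_series1 a <-> cvgn (series a).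
Proof.
rewrite -(is_cvg_series_restrict 1) /cvg_series1; split => /cvg_ex[l al];
  apply/cvg_ex; exists l.
  by rewrite -cvg_shiftS.
by move: al; rewrite -cvg_shiftS.
Qed.

Lemma near_series_le_cvg u v :
  (\forall n \near \oo, 0 <= u n) -> (\forall n \near \oo, u n <= v n) ->
  cvgn (series v) -> cvgn (series u).
Proof.
move=> u0 uv; have [N _ uvN] : \forall n \near \oo, 0 <= u n /\ u n <= v n.
  by near=> n; split; near: n.
have restr (w : nat -> R) :
    cvgn (series w) <-> cvgn (series (fun k => w (k + N)%N)).
  have -> : series (fun k => w (k + N)%N) =
      [sequence [sequence \sum_(N <= k < n) w k]_n (n + N)%N]_n.
    apply/funext => n; rewrite /series /=.
    by rewrite -[X in _ = \sum_(X <= _ < _) _]add0n big_addn addnK.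
  rewrite -(is_cvg_series_restrict N).
  by split=> /cvg_ex[l wl]; apply/cvg_ex; exists l; move: wl; rewrite cvg_shiftn.
move=> /restr cv; apply/restr; apply: series_le_cvg cv => n.
- by have [] := uvN (n + N)%N (leq_addl _ _).
- have [] := uvN (n + N)%N (leq_addl _ _); exact: le_trans.
- by have [] := uvN (n + N)%N (leq_addl _ _).
Unshelve. all: by end_near.
Qed.

Lemma is_cvg_series_lin (c d : R) u v : cvgn (series u) -> cvgn (series v) ->
  cvgn (series (fun n => c * u n + d * v n)).
Proof.
move=> cu cv.
have cdv := is_cvg_seriesZ (k := d) cv.
exact: (is_cvg_seriesD (is_cvg_seriesZ (k := c) cu) cdv).
Qed.

Lemma cvg_seq_le_const u : cvgn u -> exists K : R, forall n, `|u n| <= K.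
Proof.
move=> /cvg_seq_bounded[M [_ /(_ (M + 1))]]; rewrite ltrDl ltr01 => /(_ isT) uM.
by exists (M + 1) => n; exact: uM.
Qed.

(** Subtracting the partial sums of [e] from [a] gives a sequence [c] that is eventually
    nonincreasing and bounded below. Its decrements telescope and dominate [b]. *)
Lemma quasi_fejer_cvg a b e :
  (forall n, 0 <= a n) -> (\forall n \near \oo, 0 <= b n) ->
  (\forall n \near \oo, a n.+1 + b n <= a n + e n) ->
  cvgn (series e) -> cvgn a /\ cvgn (series b).
Proof.
move=> a0 b0 abe ce.
have [K eK] := cvg_seq_le_const ce.
pose c n := a n - series e n.
have cS n : c n - c n.+1 = a n - a n.+1 + e n.
  by rewrite /c /series /= big_nat_recr//=; ring.
have cc : cvgn c.
  have [N _ HN] : \forall n \near \oo, 0 <= b n /\ a n.+1 + b n <= a n + e n.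
    by near=> n; split; near: n.
  have : cvgn (fun n => c (n + N)%N).
    apply: nonincreasing_is_cvgn.
      apply/nonincreasing_seqP => n; rewrite addSn -subr_ge0 cS.
      by have [] := HN (n + N)%N (leq_addl _ _); lra.
    exists (- K) => _ [n _ <-]; rewrite /c.
    have := eK (n + N)%N; have := a0 (n + N)%N; rewrite ler_norml.
    by move=> ? /andP[? ?]; lra.
  by move=> /cvg_ex[l cl]; apply/cvg_ex; exists l; rewrite -(cvg_shiftn N).
split.
  have -> : a = c \+ series e by apply/funext => n; rewrite /c /= subrK.
  exact: is_cvgD.
apply: (@near_series_le_cvg _ (fun n => c n - c n.+1) b0).
  near=> n; rewrite cS; have : a n.+1 + b n <= a n + e n by near: n.
  by lra.
have -> : series (fun n => c n - c n.+1) = (fun n => c 0%N - c n).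
  apply/funext => n; elim: n => [|n ih].
    by rewrite /series /= big_geq// subrr.
  by rewrite seriesSr ih; ring.
by apply: is_cvgB => //; exact: is_cvg_cst.
Unshelve. all: by end_near.
Qed.

Lemma dvg_series1 lambda : (forall n, (1 <= n)%N -> 0 < lambda n) ->
  ~ cvg_series1 lambda ->
  forall K, \forall n \near \oo, K < \sum_(1 <= k < n.+1) lambda k.
Proof.
move=> l0 dl K.
pose tau n := \sum_(1 <= k < n.+1) lambda k.
have tauS : {homo tau : n m / (n <= m)%N >-> n <= m}.
  apply/nondecreasing_seqP => n; rewrite /tau [leRHS]big_nat_recr//= lerDl.
  by rewrite ltW// l0.
have [N KN] : exists N, K < tau N.
  apply: contrapT => h; apply: dl; apply: nondecreasing_is_cvgn => //.
  exists K => _ [n _ <-]; rewrite leNgt; apply/negP => Kn; apply: h.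
  by exists n.
by exists N => // n /= Nn; exact: lt_le_trans KN (tauS _ _ Nn).
Qed.

(** Summing the hypothesis telescopes [a], and the partial sums of [e] are bounded. The weighted sum
    is thus at most a constant plus a small multiple of the total weight, which tends to
    infinity. *)
Lemma weighted_mean_le lambda f :
  (forall n, (1 <= n)%N -> 0 < lambda n) -> ~ cvg_series1 lambda ->
  (forall eps : R, 0 < eps -> exists a e,
    [/\ forall n, 0 <= a n, cvgn (series e) &
        \forall n \near \oo,
          lambda n * f n <= a n - a n.+1 + e n + eps * lambda n]) ->
  forall eps : R, 0 < eps -> \forall n \near \oo,
    (\sum_(1 <= k < n.+1) lambda k)^-1 * \sum_(1 <= k < n.+1) lambda k * f k
      <= eps.
Proof.
move=> l0 dl H eps eps0.
have eps20 : 0 < eps / 2 by rewrite divr_gt0.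
have [a [e [a0 ce [N _ HN]]]] := H _ eps20.
have [K eK] := cvg_seq_le_const ce.
pose tau n := \sum_(1 <= k < n.+1) lambda k.
pose sf n := \sum_(1 <= k < n.+1) lambda k * f k.
(* [G] is nonincreasing from [N] on, so [G N] accounts for all the terms before the hypothesis takes
   effect. The index [n.+1] in [series e] is there because [series] stops before its argument. *)
pose G n := sf n + a n.+1 - series e n.+1 - eps / 2 * tau n.
have GN n : G (n + N)%N <= G N.
  elim: n => // n ih; apply: le_trans ih; rewrite addSn.
  have := HN (n + N).+1 (leqW (leq_addl _ _)).
  move: (n + N)%N => m; rewrite /G /sf /tau /series /=.
  rewrite !(big_nat_recr m.+1)//=.
  lra.
near=> n; rewrite -/(tau n) -/(sf n).
have tau1 : 0 < tau n by near: n; exact: dvg_series1.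
rewrite mulrC ler_pdivrMr//.
(* From here on the constant [G N + K] costs less than the remaining [eps / 2 * tau n]. *)
have : 2 / eps * (G N + K) < tau n by near: n; exact: dvg_series1.
rewrite mulrC mulrA ltr_pdivrMr// => tau2.
have : G n <= G N.
  have Nn : (N <= n)%N by near: n; exists N.
  by rewrite -(subnK Nn).
rewrite [G n]/G; have := eK n.+1; have := a0 n.+1; rewrite ler_norml.
by move=> ? /andP[? ?] ?; lra.
Unshelve. all: by end_near.
Qed.

End ScalarSequences.

(** * One step of the iteration and the Fitzpatrick gap *)

Section OneStep.
Context {R : realType} {H : completeNormedModType R}.
Context (ip : {dot H for @idfun R}).
Context (ip_norm : forall x : H, ip x x = `|x| ^+ 2).

(** The premises are, in order after the step size bound: monotonicity of [A] between [x'] and [u],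
    cocoercivity of [B] at its zero [u], and the gap bound. The reference value [d] for [Dx] is
    free: it will be [D u] for the Fejer property and [D u0] for the ergodic estimate. *)
Lemma forward_backward_step (mu delta gamma l b g : R)
    (x x' u v d Dx Bx p : H) :
  0 < delta -> delta < 1 -> 0 < l -> 0 < b ->
  l * b <= 2 * mu * (1 - delta) ^+ 2 ->
  l * gamma * `|x' - u| ^+ 2 <=
    ip (x' - u) (x - x' - l *: Dx - (l * b) *: Bx - l *: v) ->
  mu * `|Bx| ^+ 2 <= ip (x - u) Bx ->
  l * b * (ip u Bx + ip x (b^-1 *: ((2 / delta) *: p)) - ip x Bx -
           ip u (b^-1 *: ((2 / delta) *: p))) <= g ->
  `|x' - u| ^+ 2 + 2 * (l * gamma * `|x' - u| ^+ 2)
    + delta / 3 * `|x' - x| ^+ 2 + delta * (l * b * ip Bx (x - u)) <=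
  `|x - u| ^+ 2 + delta * g + 3 / delta * (l ^+ 2 * `|v + d| ^+ 2)
    + 3 / delta * (l ^+ 2 * `|Dx - d| ^+ 2)
    - 2 * (l * ip (Dx - d) (x - u)) - 2 * (l * ip (v + p + d) (x - u)).
Proof.
move=> d0 d1 l0 b0 lb hA hB hg.
pose X := x - u; pose e := x - x'; pose W := Dx - d; pose V := v + d.
have x'u : x' - u = X - e by rewrite /X /e opprB [RHS]addrC addrA subrK.
(* The Young weights [delta / 3], [delta / 3] and [1 - delta] leave
   [delta / 3 * |x' - x|^2] on the left. *)
have d3 : 0 < 3 / delta by rewrite divr_gt0.
have y1 := ip_young ip_norm (l *: W) e d3.
have y2 := ip_young ip_norm (l *: V) e d3.
have d1' : 0 < 1 - delta by lra.
have y3 : 2 * ip ((l * b) *: Bx) e <= (1 - delta)^-1 * `|(l * b) *: Bx| ^+ 2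
    + (1 - delta)^-1^-1 * `|e| ^+ 2 by apply: ip_young; rewrite ?invr_gt0.
rewrite invf_div in y1 y2; rewrite invrK in y3.
have lb0 : 0 < l * b by rewrite mulr_gt0.
rewrite !normrZ (gtr0_norm l0) !exprMn in y1 y2.
rewrite normrZ (gtr0_norm lb0) exprMn in y3.
(* Of the available [2 * (l * b * ip X Bx)], the cross term between [Bx] and [e] uses the share
   [1 - delta]. What is left, [2 * delta] times [l * b * ip X Bx], is split evenly between the left
   side of the conclusion and the gap. *)
have h3 : (1 - delta)^-1 * ((l * b) ^+ 2 * `|Bx| ^+ 2) <=
    2 * (1 - delta) * (l * b * ip X Bx).
  rewrite mulrC ler_pdivrMr//.
  apply: (@le_trans _ _ (l * b * (2 * mu * (1 - delta) ^+ 2) * `|Bx| ^+ 2)).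
    by rewrite ler_wpM2r ?sqr_ge0// expr2 ler_wpM2l// ltW.
  have -> : 2 * (1 - delta) * (l * b * ip X Bx) * (1 - delta) =
    (2 * (l * b) * (1 - delta) ^+ 2) * ip X Bx by ring.
  have -> : l * b * (2 * mu * (1 - delta) ^+ 2) * `|Bx| ^+ 2 =
    (2 * (l * b) * (1 - delta) ^+ 2) * (mu * `|Bx| ^+ 2) by ring.
  by rewrite ler_wpM2l// mulr_ge0 ?sqr_ge0// mulr_ge0 ?ltW.
have hg' : - delta * (l * b * ip X Bx) + 2 * (l * ip X p) <= delta * g.
  move: hg; rewrite -(ler_pM2l d0); apply: le_trans.
  rewrite /X !ipE le_eqVlt; apply/orP; left; apply/eqP; field.
  by rewrite !gt_eqF.
have vE : x - x' - l *: Dx - (l * b) *: Bx - l *: v =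
    e - l *: W - (l * b) *: Bx - l *: V.
  apply: (addIr (l *: V)); rewrite subrK {1}/V scalerDr addrA subrK.
  by rewrite addrAC /W scalerBr opprB [in RHS](addrC (l *: d)) addrA.
have x'x : `|x' - x| ^+ 2 = `|e| ^+ 2 by rewrite distrC.
have hX : `|x' - u| ^+ 2 = `|X| ^+ 2 - 2 * ip X e + `|e| ^+ 2.
  by rewrite x'u (normBE ip_norm).
have -> : v + p + d = V + p by rewrite addrAC.
move: hA; rewrite vE x'x -/X -/W -/V hX x'u.
clearbody X e W V.
rewrite !ipE (ipC ip Bx X) (ipC ip W X) (ipC ip V X) (ipC ip p X) ip_norm.
rewrite ipZl (ipC ip W) in y1; rewrite ipZl (ipC ip V) in y2.
rewrite ipZl (ipC ip Bx) in y3.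
move: (1 - delta)^-1 (3 / delta) h3 y1 y2 y3 => k1 k2 h3 y1 y2 y3.
lra.
Qed.

(** As [p] is normal to [C] at [u], the support function is attained at [u], and the pair [(y, B y)]
    bounds the Fitzpatrick function at [u] from below. So each term of the extended series dominates
    the real expression for every [y]. At [y = u] that expression is 0, hence the terms are
    nonnegative and the finite sum makes their real parts summable. *)
Lemma gap_summable (B : H -> H) (C : set H) (lambda beta : nat -> R) (u p : H) :
  C = zer (op_single B) ->
  (forall n, (1 <= n)%N -> 0 < lambda n) ->
  (forall n, (1 <= n)%N -> 0 < beta n) ->
  normal_cone ip C u p ->
  (\sum_(1 <= n <oo) (lambda n * beta n)%:E *
     (ereal_sup [set fitzpatrick ip (op_single B) w ((beta n)^-1 *: p)
                | w in C]
      - support_fun ip C ((beta n)^-1 *: p)) < +oo)%E ->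
  exists g : nat -> R, cvgn (series g) /\
    forall n, (1 <= n)%N -> forall y, lambda n * beta n *
      (ip u (B y) + ip y ((beta n)^-1 *: p) - ip y (B y)
       - ip u ((beta n)^-1 *: p)) <= g n.
Proof.
move=> CE l0 b0 [Cu up].
set t := (X in (\sum_(1 <= n <oo) X n)%E) => tfin.
have Bu : B u = 0 by move: Cu; rewrite CE.
have suppE n : (1 <= n)%N ->
    support_fun ip C ((beta n)^-1 *: p) = (ip u ((beta n)^-1 *: p))%:E.
  move=> n1; apply/eqP; rewrite eq_le; apply/andP; split; last first.
    by apply: ereal_sup_ubound; exists u.
  apply: ub_ereal_sup => _ [y Cy <-]; rewrite lee_fin !ipE ler_wpM2l//.
    by rewrite invr_ge0 ltW// b0.
  by have := up y Cy; rewrite !ipE subr_le0 !(ipC ip p).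
have tge n y : (1 <= n)%N -> ((lambda n * beta n *
      (ip u (B y) + ip y ((beta n)^-1 *: p) - ip y (B y)
       - ip u ((beta n)^-1 *: p)))%:E <= t n)%E.
  move=> n1; rewrite /t suppE// EFinM lee_pmul2l ?lte_fin ?mulr_gt0 ?l0 ?b0//.
  rewrite EFinB leeB//.
  apply: (@le_trans _ _ (fitzpatrick ip (op_single B) u ((beta n)^-1 *: p))).
    by apply: ereal_sup_ubound; exists (y, B y).
  by apply: ereal_sup_ubound; exists u.
have t0 n : (1 <= n)%N -> (0 <= t n)%E.
  by move=> /(tge n u); rewrite Bu linear0r add0r subr0 subrr mulr0.
have t_lim n : (\sum_(1 <= k < n.+1) t k <= \sum_(1 <= k <oo) t k)%E.
  by apply: nneseries_lim_ge => k k1 _; exact: t0.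
have t_fin n : (1 <= n)%N -> t n \is a fin_num.
  move=> n1; rewrite ge0_fin_numE ?t0//; apply: le_lt_trans tfin.
  apply: le_trans (t_lim n); rewrite big_nat_recr//= leeDr//.
  by rewrite big_nat_cond; apply: sume_ge0 => k /andP[/andP[k1 _] _]; exact: t0.
exists (fine \o t); split; last first.
  by move=> n n1 y; rewrite -lee_fin /= fineK ?t_fin//; exact: tge.
apply: (cvg_series1E (fine \o t)).1.
apply: (@nondecreasing_is_cvgn R (fun n => \sum_(1 <= k < n.+1) fine (t k))).
  apply/nondecreasing_seqP => n; rewrite [leRHS]big_nat_recr//= lerDl.
  by rewrite fine_ge0// t0.
have S_fin : (\sum_(1 <= k <oo) t k)%E \is a fin_num.
  rewrite ge0_fin_numE//; apply: nneseries_ge0 => k k1 _; exact: t0.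
exists (fine (\sum_(1 <= k <oo) t k)%E) => _ [n _ <-].
rewrite -lee_fin fineK// -sumEFin; apply: le_trans (t_lim n).
rewrite le_eqVlt; apply/orP; left; apply/eqP.
by apply: eq_big_nat => k /andP[k1 _]; rewrite /= fineK// t_fin.
Qed.

End OneStep.

(** * Limits of real sequences and weak neighbourhoods *)

Section Limits.
Context {R : realType} {H : completeNormedModType R}.
Implicit Types (ip : {dot H for @idfun R}).

Lemma limn_esup_lt_near (a : nat -> R) (b : R) :
  (limn_esup (fun n => (a n)%:E) < b%:E)%E ->
  exists2 q, q < b & \forall n \near \oo, a n <= q.
Proof.
rewrite /limn_esup limf_esupE => /ereal_inf_lt[_ [V Voo <-]].
have Va n : V n -> ((a n)%:E <= ereal_sup [set (a k)%:E | k in V])%E.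
  by move=> Vn; apply: ereal_sup_ubound; exists n.
case: (ereal_sup _) Va => [q||] Va // qb.
- by exists q => //; apply: filterS Voo => n /Va; rewrite lee_fin.
(* A supremum equal to [-oo] forces [V] to be empty, so any number below [b] would do. *)
- by exists (b - 1); [rewrite ltrBlDr ltrDl|apply: filterS Voo => n /Va].
Qed.

Lemma cvg0_le_scale (a b : nat -> R) (c : R) : 0 < c ->
  (\forall n \near \oo, 0 <= a n) -> (\forall n \near \oo, c * a n <= b n) ->
  b n @[n --> \oo] --> 0 -> a n @[n --> \oo] --> 0.
Proof.
move=> c0 a0 ab b0.
apply: (@squeeze_cvgr _ _ _ _ (fun=> 0) (fun n => c^-1 * b n)).
- near=> n; apply/andP; split; first by near: n.
  by rewrite [leRHS]mulrC ler_pdivlMr// mulrC; near: n.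
- exact: cvg_cst.
- by rewrite -[X in _ --> X](mulr0 c^-1); apply: cvgM => //; exact: cvg_cst.
Unshelve. all: by end_near.
Qed.

Lemma cocoercive_ip_zero ip (mu : R) (f : H -> H) u y :
  cocoercive ip mu f -> f u = 0 -> mu * `|f y| ^+ 2 <= ip (f y) (y - u).
Proof. by move=> fcoco fu; have := fcoco y u; rewrite fu subr0 ipC. Qed.

Lemma weak_nbhs_halfspace ip (c v : H) (e : R) : 0 < e ->
  nbhs (c : weak_space ip) [set y | ip y v < ip c v + e].
Proof.
move=> e0; pose f (y : weak_space ip) : {ptws H -> R} := ip y.
have fc : {for c, continuous f} by exact: initial_continuous.
have FF : Filter (f @ nbhs (c : weak_space ip)) by exact: fmap_filter.
have /(_ FF v) :=
  (@pointwise_cvgP H R (f @ nbhs (c : weak_space ip)) (f c) _).1 fc.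
move=> /(_ [set r | r < ip c v + e]); apply.
by apply: lt_nbhsl; rewrite ltrDl.
Qed.

Lemma cvg_sqr_norm0 (y : nat -> H) :
  `|y n| ^+ 2 @[n --> \oo] --> 0 -> `|y n| @[n --> \oo] --> 0.
Proof.
move=> y0.
have -> : (fun n => `|y n|) = Num.sqrt \o (fun n => `|y n| ^+ 2).
  by apply/funext => n /=; rewrite sqrtr_sqr normr_id.
by rewrite -sqrtr0; apply: continuous_cvg => //; exact: sqrt_continuous.
Qed.

End Limits.

(** * The penalty scheme: Fejer property, ergodic and strong limits, weak cluster points *)

Section PenaltyScheme.
Context {R : realType} {H : completeNormedModType R}.
Context (ip : {dot H for @idfun R}).
Context (ip_norm : forall x : H, ip x x = `|x| ^+ 2).
Context (A : H -> set H) (D B : H -> H) (eta mu gamma : R) (C : set H).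
Context (gamma_ge0 : 0 <= gamma).
Context (A_mono : forall x u y v, A x u -> A y v ->
  gamma * `|x - y| ^+ 2 <= ip (x - y) (u - v)).
Context (eta_gt0 : 0 < eta) (D_coco : cocoercive ip eta D).
Context (mu_gt0 : 0 < mu) (B_coco : cocoercive ip mu B).
Context (C_def : C = zer (op_single B)).
Context (lambda beta : nat -> R).
Context (lambda_gt0 : forall n, (1 <= n)%N -> 0 < lambda n).
Context (beta_gt0 : forall n, (1 <= n)%N -> 0 < beta n).
Context (x : nat -> H).
Context (x_rec : forall n, (1 <= n)%N ->
  resolvent (op_scale (lambda n) A)
    (x n - lambda n *: D (x n) - (lambda n * beta n) *: B (x n)) (x n.+1)).
Context (gap_finite : forall p, ran (normal_cone ip C) p ->
  (\sum_(1 <= n <oo) (lambda n * beta n)%:E *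
     (ereal_sup [set fitzpatrick ip (op_single B) u ((beta n)^-1 *: p)
                | u in C]
      - support_fun ip C ((beta n)^-1 *: p)) < +oo)%E).
Context (lambda_l2 : cvgn (series (fun n => lambda n ^+ 2))).
Context (delta : R) (delta_gt0 : 0 < delta) (delta_lt1 : delta < 1).
Context (lb_small : \forall n \near \oo,
  lambda n * beta n <= 2 * mu * (1 - delta) ^+ 2).

Lemma lambda_near (e : R) : 0 < e -> \forall n \near \oo, lambda n <= e.
Proof.
move=> e0; have /cvgrPdist_lt/(_ (e ^+ 2)) := cvg_series_cvg_0 lambda_l2.
rewrite exprn_gt0// => /(_ isT) l2.
near=> n.
have ln : 0 < lambda n by apply: lambda_gt0; near: n; exists 1%N.
rewrite -(@ler_pXn2r _ 2) ?nnegrE ?(ltW ln) ?(ltW e0)//.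
have : `|0 - lambda n ^+ 2| < e ^+ 2 by near: n.
by rewrite sub0r normrN ger0_norm ?sqr_ge0// => /ltW.
Unshelve. all: by end_near.
Qed.

Lemma penalty_descent (u v p : H) : A u v -> normal_cone ip C u p ->
  exists g : nat -> R, cvgn (series g) /\
  \forall n \near \oo, forall d,
  `|x n.+1 - u| ^+ 2 + 2 * (lambda n * gamma * `|x n.+1 - u| ^+ 2)
    + delta / 3 * `|x n.+1 - x n| ^+ 2
    + delta * (lambda n * beta n * ip (B (x n)) (x n - u)) <=
  `|x n - u| ^+ 2 + delta * g n + 3 / delta * (lambda n ^+ 2 * `|v + d| ^+ 2)
    + 3 / delta * (lambda n ^+ 2 * `|D (x n) - d| ^+ 2)
    - 2 * (lambda n * ip (D (x n) - d) (x n - u))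
    - 2 * (lambda n * ip (v + p + d) (x n - u)).
Proof.
move=> Auv Np.
have d20 : 0 < 2 / delta by rewrite divr_gt0.
(* The gap hypothesis is used at [(2 / delta) *: p], so that the share [delta]
   of the penalty term absorbs [2 * lambda n * ip p (x n - u)]. *)
have Np' : normal_cone ip C u ((2 / delta) *: p).
  move: Np => [Cu up]; split=> // y Cy.
  by rewrite ipZl; apply: mulr_ge0_le0; rewrite ?up// ltW.
have [|g [cg gP]] := gap_summable C_def lambda_gt0 beta_gt0 Np'.
  by apply: gap_finite; exists u.
exists g; split=> //; near=> n => d.
have n1 : (1 <= n)%N by near: n; exists 1%N.
have ln := lambda_gt0 n1.
apply: (@forward_backward_step _ _ _ ip_norm mu delta gamma (lambda n) (beta n)
  (g n) (x n) (x n.+1) u v d (D (x n)) (B (x n)) p delta_gt0 delta_lt1 ln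
  (beta_gt0 n1)).
- by near: n.
(* The resolvent provides [w] in [A (x n.+1)] such that the forward point is
   [x n.+1 + lambda n *: w]. *)
- have [_ /= -> [_ [w Aw <-]]] := x_rec n1; rewrite /= => xE.
  have -> : x n - x n.+1 - lambda n *: D (x n) -
      (lambda n * beta n) *: B (x n) - lambda n *: v = lambda n *: (w - v).
    rewrite scalerBr; congr (_ - _); apply: (addrI (x n.+1)).
    by rewrite [RHS]xE addrC -!addrA (addrC (- x n.+1)) !addrA addrK.
  by rewrite ipZr -mulrA ler_pM2l//; exact: A_mono.
- have Bu : B u = 0 by case: Np; rewrite C_def.
  by have := B_coco (x n) u; rewrite Bu subr0.
- exact: gP.
Unshelve. all: by end_near.
Qed.

Let Z := zer (op_add (op_add A (op_single D)) (normal_cone ip C)).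

(** This is the form in which maximality of [A + N_C] can produce elements of [Z]. *)
Lemma zer_sumP u : Z u <-> op_add A (normal_cone ip C) u (- D u).
Proof.
split.
  move=> [_ [a Aa [_ -> <-]]] [p Np] /= E.
  exists a => //; exists p => //; apply/eqP; rewrite -addr_eq0.
  by rewrite addrAC E.
move=> [a Aa [p Np E]]; exists (a + D u).
  by exists a => //; exists (D u).
by exists p => //; rewrite addrAC E addNr.
Qed.

(** With [d := D u] the vector [v + p + d] vanishes, so no linear term in [x n - u] survives apart
    from the one in [D], which cocoercivity makes favourable. All nonnegative leftovers are gathered
    in [b]. *)
Lemma penalty_fejer u : Z u ->
  [/\ cvgn (fun n => `|x n - u|),
      cvgn (series (fun n => `|x n.+1 - x n| ^+ 2)),
      cvgn (series (fun n => lambda n * beta n * ip (B (x n)) (x n - u))),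
      cvgn (series (fun n => lambda n * `|D (x n) - D u| ^+ 2)) &
      cvgn (series (fun n => lambda n * gamma * `|x n.+1 - u| ^+ 2))].
Proof.
move=> /zer_sumP[v Av [p Np vpE]].
have [g [cg [N _ gP]]] := penalty_descent Av Np.
have Bu : B u = 0 by case: Np; rewrite C_def.
pose t1 n := `|x n.+1 - x n| ^+ 2.
pose t2 n := lambda n * beta n * ip (B (x n)) (x n - u).
pose t3 n := lambda n * `|D (x n) - D u| ^+ 2.
pose t4 n := lambda n * gamma * `|x n.+1 - u| ^+ 2.
pose b n := 2 * t4 n + delta / 3 * t1 n + delta * t2 n + eta * t3 n.
pose k := 3 / delta * `|v + D u| ^+ 2.
have k1 : 0 < 3 / delta by rewrite divr_gt0.
have n1 : \forall n \near \oo, (1 <= n)%N by exists 1%N.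
have t10 : \forall n \near \oo, 0 <= t1 n.
  by near=> n; exact: sqr_ge0.
have t20 : \forall n \near \oo, 0 <= t2 n.
  near=> n; have n1' : (1 <= n)%N by near: n.
  apply: mulr_ge0; first by rewrite mulr_ge0 ?ltW ?lambda_gt0 ?beta_gt0.
  apply: le_trans (cocoercive_ip_zero (x n) B_coco Bu).
  by rewrite mulr_ge0 ?sqr_ge0// ltW.
have t30 : \forall n \near \oo, 0 <= t3 n.
  near=> n; have n1' : (1 <= n)%N by near: n.
  by rewrite mulr_ge0 ?sqr_ge0// ltW// lambda_gt0.
have t40 : \forall n \near \oo, 0 <= t4 n.
  near=> n; have n1' : (1 <= n)%N by near: n.
  by rewrite mulr_ge0 ?sqr_ge0// mulr_ge0// ltW// lambda_gt0.
have d3 : 0 < delta / 3 by rewrite divr_gt0.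
have bpos : \forall n \near \oo,
    [/\ 0 <= 2 * t4 n, 0 <= delta / 3 * t1 n, 0 <= delta * t2 n
      & 0 <= eta * t3 n].
  near=> n; split; (apply: mulr_ge0; first exact: ltW); by near: n.
have [ca cb] : cvgn (fun n => `|x n - u| ^+ 2) /\ cvgn (series b).
  apply: (@quasi_fejer_cvg _ _ _ (fun n => delta * g n + k * lambda n ^+ 2)).
  - by move=> n; exact: sqr_ge0.
  - by apply: filterS bpos => n [? ? ? ?]; rewrite /b !addr_ge0.
  - near=> n.
    have n1' : (1 <= n)%N by near: n.
    have ln := lambda_gt0 n1'.
    (* Cocoercivity yields [2 * eta * t3 n]. For small steps one half absorbs the quadratic error in
       [D], and the other half stays in [b]. *)
    have : lambda n <= eta / (3 / delta).
      by near: n; apply: lambda_near; rewrite divr_gt0.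
    rewrite ler_pdivlMr// => ll.
    have h : 3 / delta * (lambda n ^+ 2 * `|D (x n) - D u| ^+ 2) <= eta * t3 n.
      have -> : 3 / delta * (lambda n ^+ 2 * `|D (x n) - D u| ^+ 2) =
         (lambda n * (3 / delta)) * t3 n by rewrite /t3; ring.
      by rewrite ler_wpM2r//; near: n.
    have h' : eta * t3 n <= lambda n * ip (D (x n) - D u) (x n - u).
      rewrite /t3 mulrCA ler_pM2l// (ipC ip (_ - _)); exact: D_coco.
    have Nn : (N <= n)%N by near: n; exists N.
    have := gP n Nn (D u); rewrite vpE addNr linear0l mulr0 mulr0 subr0 => gn.
    have : k * lambda n ^+ 2 = 3 / delta * (lambda n ^+ 2 * `|v + D u| ^+ 2).
      by rewrite /k; ring.
    move: gn h h'; rewrite /b -/(t1 n) -/(t2 n) -/(t4 n).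
    lra.
  - exact: is_cvg_series_lin.
have part (t : nat -> R) (c : R) : 0 < c -> (\forall n \near \oo, 0 <= t n) ->
    (\forall n \near \oo, c * t n <= b n) -> cvgn (series t).
  move=> c0 t0 tb; have := is_cvg_series_lin (c := c^-1) (d := 0) cb cb.
  apply: near_series_le_cvg => //.
  near=> n; rewrite mul0r addr0 mulrC ler_pdivlMr// mulrC.
  by near: n.
split.
- have -> : (fun n => `|x n - u|) = Num.sqrt \o (fun n => `|x n - u| ^+ 2).
    by apply/funext => n /=; rewrite sqrtr_sqr normr_id.
  move/cvg_ex : ca => [l al]; apply/cvg_ex; exists (Num.sqrt l).
  by apply: continuous_cvg => //; exact: sqrt_continuous.
- apply: part d3 t10 _; apply: filterS bpos => n [? ? ? ?].
  by rewrite /b; lra.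
- apply: part delta_gt0 t20 _; apply: filterS bpos => n [? ? ? ?].
  by rewrite /b; lra.
- apply: part eta_gt0 t30 _; apply: filterS bpos => n [? ? ? ?].
  by rewrite /b; lra.
- apply: part (ltr0n _ 2) t40 _; apply: filterS bpos => n [? ? ? ?].
  by rewrite /b; lra.
Unshelve. all: by end_near.
Qed.

Context (lambda_dvg : ~ cvg_series1 lambda).
Context (M_max : maximally_monotone ip (op_add A (normal_cone ip C))).
Context (u0 : H) (Zu0 : Z u0).

Let z := weighted_mean lambda x.

Lemma iterates_bounded : exists2 K, 0 < K & forall n, `|x n| <= K.
Proof.
have [/cvg_seq_le_const[K KP] _ _ _ _] := penalty_fejer Zu0.
exists (`|K| + `|u0| + 1) => [|n].
  by rewrite ltr_wpDl// addr_ge0.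
have := ler_normD (x n - u0) u0; rewrite subrK => /le_trans; apply.
have := KP n; rewrite normr_id => h.
by rewrite -addrA lerD ?(le_trans h) ?ler_norm// lerDl.
Qed.

Lemma dist_bounded u : exists2 K, 0 < K & forall n, `|x n - u| ^+ 2 <= K.
Proof.
have [K K0 KP] := iterates_bounded.
exists ((K + `|u|) ^+ 2) => [|n]; first by rewrite exprn_gt0// ltr_wpDr.
rewrite lerXn2r ?nnegrE ?addr_ge0 ?(ltW K0)//.
by apply: le_trans (ler_normB _ _) _; rewrite lerD2r.
Qed.

Lemma ip_weighted_mean w (c : R) n : 0 < \sum_(1 <= k < n.+1) lambda k ->
  (\sum_(1 <= k < n.+1) lambda k)^-1 *
    \sum_(1 <= k < n.+1) lambda k * (ip w (x k) - c) = ip w (z n) - c.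
Proof.
move=> t0; rewrite /z /weighted_mean ipZr (ipC ip w) ip_sumZl.
under [X in _ * X = _]eq_bigr do rewrite mulrBr.
rewrite sumrB mulrBr -mulr_suml mulKf ?gt_eqF//.
by congr (_ * _ - _); apply: eq_bigr => k _; rewrite ipC.
Qed.

Lemma weighted_mean_ip_le w (c : R) :
  (forall eps : R, 0 < eps -> exists a e : nat -> R,
    [/\ forall n, 0 <= a n, cvgn (series e) &
        \forall n \near \oo,
          lambda n * (ip w (x n) - c) <= a n - a n.+1 + e n + eps * lambda n]) ->
  forall eps : R, 0 < eps -> \forall n \near \oo, ip (z n) w <= c + eps.
Proof.
move=> h eps e0; have {h}h := weighted_mean_le lambda_gt0 lambda_dvg h e0.
near=> n; have t0 : 0 < \sum_(1 <= k < n.+1) lambda k.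
  by near: n; exact: dvg_series1.
rewrite -lerBlDl ipC -ip_weighted_mean//; near: n; exact: h.
Unshelve. all: by end_near.
Qed.

Lemma weighted_mean_bounded : exists K : R, \forall n \near \oo, `|z n| <= K.
Proof.
have [K K0 KP] := iterates_bounded; exists K; near=> n.
have t0 : 0 < \sum_(1 <= k < n.+1) lambda k.
  by near: n; exact: dvg_series1.
rewrite /z /weighted_mean normrZ gtr0_norm ?invr_gt0// mulrC ler_pdivrMr//.
apply: le_trans (ler_norm_sum _ _ _) _; rewrite mulr_sumr.
rewrite !big_seq; apply: ler_sum => k; rewrite mem_index_iota => /andP[k1 _].
by rewrite normrZ gtr0_norm ?lambda_gt0// mulrC ler_wpM2r// ltW// lambda_gt0.
Unshelve. all: by end_near.
Qed.

(** Adding [(c, m)] to the graph keeps it monotone, so the point was already there. *)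
Lemma maximally_monotone_mem (M : H -> set H) c m : maximally_monotone ip M ->
  (forall u w, M u w -> 0 <= ip (u - c) (w - m)) -> M c m.
Proof.
move=> [Mm Mmax] h.
pose N : H -> set H := fun u => [set w | M u w \/ (u = c /\ w = m)].
suff E : Gr N = Gr M.
  have : Gr N (c, m) by right.
  by rewrite E.
apply: Mmax => [u w u' w'|[u w] Muw]; last by left.
move=> [Muw|[-> ->]] [Mu'w'|[-> ->]].
- exact: Mm.
- exact: h.
- by rewrite -opprB ipNl -(opprB w') ipNr opprK; exact: h.
- by rewrite !subrr linear0l.
Qed.

(* Cocoercivity of [D] makes [D x_n] converge to [D u0] in weighted mean, so that
   [D] may be replaced by the constant [D u0] in the asymptotic inequalities. *)
Lemma weighted_mean_graph_le u w : op_add A (normal_cone ip C) u w ->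
  forall eps : R, 0 < eps -> \forall n \near \oo,
    ip (z n) (w + D u0) <= ip u (w + D u0) + eps.
Proof.
move=> [v Av [p Np <-]]; apply: weighted_mean_ip_le => eps e0.
have [g [cg [N _ gP]]] := penalty_descent Av Np.
have [_ _ _ cD _] := penalty_fejer Zu0.
have [K K0 KP] := dist_bounded u.
pose d := D u0; pose V := `|v + d| ^+ 2.
pose t := eps / K.
have t0 : 0 < t by rewrite divr_gt0.
pose S n := lambda n * `|D (x n) - d| ^+ 2.
(* These are the terms of [penalty_descent] halved. In the error, [3 / delta] comes with
   [lambda n <= 1], and [t^-1] comes from Young applied to the inner product of [D (x n) - d] and
   [x n - u], where [t = eps / K] turns the squared distance into [eps]. *)
exists (fun n => `|x n - u| ^+ 2 / 2).
exists (fun n => 1 * (delta / 2 * g n + (3 / delta * V) / 2 * lambda n ^+ 2)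
                 + (3 / delta + t^-1) / 2 * S n).
split.
- by move=> n; rewrite divr_ge0// sqr_ge0.
- by apply: is_cvg_series_lin => //; exact: is_cvg_series_lin.
near=> n.
have n1 : (1 <= n)%N by near: n; exists 1%N.
have ln := lambda_gt0 n1.
have l1 : lambda n <= 1 by near: n; exact: lambda_near.
have Nn : (N <= n)%N by near: n; exists N.
have k0 : 0 < 3 / delta by rewrite divr_gt0.
have := gP n Nn d.
have h1 : 0 <= 2 * (lambda n * gamma * `|x n.+1 - u| ^+ 2)
    + delta / 3 * `|x n.+1 - x n| ^+ 2
    + delta * (lambda n * beta n * ip (B (x n)) (x n - u)).
  rewrite !addr_ge0//.
  - by rewrite !mulr_ge0 ?sqr_ge0// ltW.
  - by rewrite !mulr_ge0 ?sqr_ge0// ?ltW// ?invr_gt0//.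
  - apply: mulr_ge0; first exact: ltW.
    apply: mulr_ge0; first by rewrite mulr_ge0 ?ltW ?beta_gt0.
    have Bu : B u = 0 by case: Np; rewrite C_def.
    apply: le_trans (cocoercive_ip_zero (x n) B_coco Bu).
    by rewrite mulr_ge0 ?sqr_ge0// ltW.
have h2 : lambda n ^+ 2 * `|D (x n) - d| ^+ 2 <= S n.
  by rewrite /S expr2 -mulrA ler_piMl// mulr_ge0 ?sqr_ge0// ltW.
have h2' := ler_wpM2l (ltW k0) h2.
have : - (2 * ip (D (x n) - d) (x n - u)) <=
    t^-1 * `|D (x n) - d| ^+ 2 + eps.
  have t'0 : 0 < t^-1 by rewrite invr_gt0.
  have := ip_young ip_norm (D (x n) - d) (- (x n - u)) t'0.
  rewrite ipNr mulrN normrN invrK => /le_trans; apply; rewrite lerD2l.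
  by rewrite /t mulrAC ler_pdivrMr// ler_wpM2l// ltW.
rewrite -(ler_pM2l ln) => h3.
rewrite (ipC ip (v + p + d)) -/d -/V.
have e1 : lambda n * (ip (v + p + d) (x n) - ip u (v + p + d)) =
  lambda n * ip (x n - u) (v + p + d).
  by rewrite !ipE !(ipC ip _ (x n)); ring.
rewrite e1.
have e2 : lambda n * (t^-1 * `|D (x n) - d| ^+ 2 + eps) =
    t^-1 * S n + eps * lambda n.
  by rewrite /S; ring.
rewrite e2 in h3.
move: (3 / delta) (t^-1) h2' h3 h1 => q r h2' h3 h1.
have h4 : 0 <= eps * lambda n by rewrite mulr_ge0// ltW.
lra.
Unshelve. all: by end_near.
Qed.

(** Inequalities valid for almost all [n] hold along [F] and pass to the center [c]. The graph
    inequalities and maximality put [- D u0] in [(A + N_C) c], and cocoercivity gives [D c = D u0].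
    A general [F] is needed because Opial's argument restricts to a set of indices. *)
Lemma ergodic_center (F : set_system nat) {FF : ProperFilter F} :
  (forall P : set nat, (\forall n \near \oo, P n) -> F P) ->
  exists2 c, Z c & forall w (a : R), (\forall n \near F, ip (z n) w <= a) ->
    ip c w <= a.
Proof.
move=> Foo.
have [K /Foo zK] := weighted_mean_bounded.
have [c cP] := asymptotic_center ip_norm zK; exists c => //.
pose d := D u0.
have Mc : op_add A (normal_cone ip C) c (- d).
  apply: maximally_monotone_mem M_max _ => u w Muw.
  rewrite opprK ipDl ipNl subr_ge0; apply/ler_addgt0Pr => eps e0.
  by apply: cP; apply: Foo; exact: weighted_mean_graph_le.
have [_ _ _ cD _] := penalty_fejer Zu0.
have [L L0 LP] := dist_bounded c.
suff dE : D c = d by apply/zer_sumP; rewrite dE.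
apply/eqP; rewrite -subr_eq0 -normr_eq0 -sqrf_eq0 eq_le sqr_ge0 andbT.
rewrite -(@pmulr_rle0 _ (eta / 2)) ?divr_gt0//.
apply/ler_addgt0Pr => eps e0; rewrite add0r.
(* Here [c] is tested against a half-space with normal [D c - d]: membership leaves no room for
   [D c - d] to be nonzero. *)
suff : ip c (D c - d) <= ip c (D c - d) - eta / 2 * `|D c - d| ^+ 2 + eps.
  by lra.
apply: cP; apply: Foo; apply: weighted_mean_ip_le => // {e0}eps e0.
pose S n := lambda n * `|D (x n) - d| ^+ 2.
pose t := eps / L.
have t0 : 0 < t by rewrite divr_gt0.
(* Nothing telescopes here: the whole error is a multiple of the summable [S], up to the [eps]
   produced by Young. *)
exists (fun=> 0), (fun n => eta * S n + t^-1 / 2 * S n); split => //.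
  exact: is_cvg_series_lin.
near=> n.
have n1 : (1 <= n)%N by near: n; exists 1%N.
have ln := lambda_gt0 n1.
rewrite subrr add0r.
have -> : eta * S n + t^-1 / 2 * S n + eps * lambda n =
  lambda n * ((eta + t^-1 / 2) * `|D (x n) - d| ^+ 2 + eps) by rewrite /S; ring.
rewrite ler_pM2l//.
have y1 := ip_young ip_norm (x n - c) (D (x n) - d) t0.
have h1 : t * `|x n - c| ^+ 2 <= eps.
  by rewrite /t mulrAC ler_pdivrMr// ler_wpM2l// ltW.
have y2 := D_coco (x n) c.
have y3 : `|D c - d| ^+ 2 <=
    2 * `|D (x n) - D c| ^+ 2 + 2 * `|D (x n) - d| ^+ 2.
  have -> : D c - d = (D (x n) - d) - (D (x n) - D c).
    by rewrite opprB [RHS]addrC addrA subrK.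
  by rewrite [leRHS]addrC; exact: (normB_sqr_le ip_norm).
have y4 := ler_wpM2l (ltW eta_gt0) y3.
have y5 : ip (D c - d) (x n) - ip c (D c - d) =
    ip (x n - c) (D (x n) - d) - ip (x n - c) (D (x n) - D c).
  by rewrite !ipE (ipC ip _ (x n)) (ipC ip _ (x n)); ring.
move: (t^-1) y1 => r y1.
lra.
Unshelve. all: by end_near.
Qed.

(** The upper half of the weighted Cesaro theorem; the lower half follows with [- w]. *)
Lemma weighted_mean_cvg_ip w (l : R) : ip (x n) w @[n --> \oo] --> l ->
  forall eps : R, 0 < eps -> \forall n \near \oo, ip (z n) w <= l + eps.
Proof.
move=> /cvgrPdist_le xl; apply: weighted_mean_ip_le => eps e0.
exists (fun=> 0), (fun=> 0); split => //.
  have -> : series (fun=> 0 : R) = (fun=> 0).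
    by apply/funext => n; rewrite /series /= big1.
  exact: is_cvg_cst.
near=> n.
have n1 : (1 <= n)%N by near: n; exists 1%N.
rewrite subrr !add0r mulrC ler_pM2r ?lambda_gt0//.
have : `|l - ip (x n) w| <= eps by near: n; exact: xl.
by rewrite ipC ler_norml => /andP[? ?]; lra.
Unshelve. all: by end_near.
Qed.

(* Opial: the difference of squared distances to two points of [Z] is affine
   in [x_n]. *)
Lemma zer_diff_cvg c c' : Z c -> Z c' ->
  exists l : R, ip (x n) (c - c') @[n --> \oo] --> l.
Proof.
move=> /penalty_fejer[/cvg_ex[l1 h1] _ _ _ _].
move=> /penalty_fejer[/cvg_ex[l2 h2] _ _ _ _].
exists (2^-1 * (l2 * l2 - l1 * l1 + (`|c| ^+ 2 - `|c'| ^+ 2))).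
have -> : (fun n => ip (x n) (c - c')) = (fun n => 2^-1 *
    (`|x n - c'| * `|x n - c'| - `|x n - c| * `|x n - c|
     + (`|c| ^+ 2 - `|c'| ^+ 2))).
  by apply/funext => n; rewrite -!expr2 !(normBE ip_norm) !ipE; field.
apply: cvgM; first exact: cvg_cst.
apply: cvgD; last exact: cvg_cst.
by apply: cvgB; apply: cvgM.
Qed.

Lemma weighted_mean_weak_cvg : exists2 c, Z c & weak_cvg ip z c.
Proof.
have [c Zc cP] := @ergodic_center \oo _ (fun P => id).
exists c => //; apply/weak_cvgP => w.
suff H1 : forall w (eps : R), 0 < eps ->
    \forall n \near \oo, ip (z n) w <= ip c w + eps.
  apply/cvgrPdist_le => eps e0; near=> n; rewrite ler_norml.
  have h1 : ip (z n) w <= ip c w + eps by near: n; exact: H1.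
  have : ip (z n) (- w) <= ip c (- w) + eps by near: n; exact: H1.
  by rewrite !ipNr => h2; apply/andP; split; lra.
move=> {}w eps e0; apply: contrapT => nP.
(* If the bound fails infinitely often, the trace of [\oo] on the bad indices is proper. Its center
   [c'] also lies in [Z], yet is separated from [c] in the direction [w]. *)
pose F := within [set n | ip c w + eps < ip (z n) w] \oo.
have FF : ProperFilter F.
  apply: Build_ProperFilter => F0; apply: nP.
  have {}F0 : \forall n \near \oo, ip c w + eps < ip (z n) w -> False by [].
  by apply: filterS F0 => n h; rewrite leNgt; apply/negP.
have [c' Zc' c'P] := @ergodic_center F FF (fun P => @cvg_within _ \oo _ _ P).
have c'w : ip c w + eps <= ip c' w.
  rewrite -lerN2 -ipNr; apply: c'P.
  apply: filterS (withinT _ _) => n /= /ltW; by rewrite ipNr lerN2.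
have [l xl] := zer_diff_cvg Zc Zc'.
have xlN : ip (x n) (- (c - c')) @[n --> \oo] --> - l.
  under eq_fun do rewrite ipNr.
  exact: cvgN.
(* Both centers inherit the limit [l] of [ip (x n) (c - c')] through the means, one from each side,
   which forces [c = c']. *)
have h1 : ip c (c - c') <= l.
  apply/ler_addgt0Pr => e {}e0; apply: cP; exact: weighted_mean_cvg_ip.
have h2 : ip c' (- (c - c')) <= - l.
  apply/ler_addgt0Pr => e {}e0; apply: c'P; apply: cvg_within.
  exact: weighted_mean_cvg_ip.
have : `|c - c'| ^+ 2 <= 0.
  by rewrite -ip_norm ipDl ipNl; move: h2; rewrite ipNr; lra.
rewrite exprn_even_le0//= normr_eq0 subr_eq0 => /eqP cc'.
by move: c'w; rewrite cc' gerDl leNgt e0.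
Unshelve. all: by end_near.
Qed.

Lemma strongly_monotone_cvg u : 0 < gamma -> Z u -> x @ \oo --> u.
Proof.
move=> g0 Zu; have [/cvg_ex[l xl] _ _ _ cg] := penalty_fejer Zu.
suff l0 : l = 0.
  apply/cvgrPdist_lt => e e0; move/cvgrPdist_lt: xl => /(_ e e0).
  by apply: filterS => n; rewrite l0 sub0r normrN normr_id distrC.
have l_ge0 : 0 <= l by apply: (cvgr_to_ge xl); exact: nearW.
apply/eqP; rewrite eq_le l_ge0 andbT leNgt; apply/negP => l0.
apply: lambda_dvg; apply: (cvg_series1E _).2.
(* Eventually [|x n.+1 - u|] is at least [l / 2], so [lambda n] is at most [k] times a summable
   term. *)
pose k := (gamma * (l / 2) ^+ 2)^-1.
have k0 : 0 < gamma * (l / 2) ^+ 2.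
  by rewrite mulr_gt0// exprn_gt0// divr_gt0.
have xS : `|x n.+1 - u| @[n --> \oo] --> l.
  by rewrite (cvg_shiftS (fun n => `|x n - u|)).
have := is_cvg_series_lin (c := k) (d := 0) cg cg.
apply: near_series_le_cvg; near=> n;
  have n1 : (1 <= n)%N by [near: n; exists 1%N].
  by rewrite ltW// lambda_gt0.
have xn : l / 2 <= `|x n.+1 - u|.
  near: n; apply: (cvgr_ge l xS); lra.
rewrite mul0r addr0 mulrC ler_pdivlMr// mulrA.
rewrite ler_wpM2l ?lerXn2r ?nnegrE ?divr_ge0// mulr_ge0// ltW// lambda_gt0.
Unshelve. all: by end_near.
Qed.

(** Cocoercivity between [x n] and a cluster point [c] bounds [mu * |B c| ^+ 2] by terms in
    [B (x n)] and the product of [x n - c] with [- B c]. The latter is small whenever [x n] is in a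
    suitable weak half-space around [c]. *)
Lemma weak_cluster_zer : `|B (x n)| @[n --> \oo] --> 0 ->
  weak_cluster ip x `<=` C.
Proof.
move=> Bx c cc; rewrite C_def /zer /op_single /=; apply/esym/eqP.
rewrite -normr_eq0 -sqrf_eq0 eq_le sqr_ge0 andbT.
rewrite -(@pmulr_rle0 _ mu)//; apply/ler_addgt0Pr => e e0; rewrite add0r.
have [K K0 KP] := dist_bounded c.
pose t := e / (4 * K).
have t0 : 0 < t by rewrite divr_gt0// mulr_gt0.
have tK : t * K = e / 4 by rewrite /t; field; rewrite gt_eqF.
(* The total coefficient of [|B (x n)| ^+ 2], from Young and from splitting [|B c| ^+ 2]. *)
pose r := t^-1 + 2 * mu.
have r0 : 0 < r by rewrite addr_gt0 ?mulr_gt0 ?invr_gt0.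
have e40 : 0 < e / 4 by rewrite divr_gt0.
have Bxr : \forall n \near \oo, r * `|B (x n)| ^+ 2 <= e / 4.
  have s0 : 0 < Num.sqrt (e / 4 / r) by rewrite sqrtr_gt0 !divr_gt0.
  move/cvgrPdist_le: Bx => /(_ _ s0); apply: filterS => n.
  rewrite sub0r normrN normr_id => Bs.
  have : `|B (x n)| ^+ 2 <= Num.sqrt (e / 4 / r) ^+ 2.
    by rewrite lerXn2r ?nnegrE ?sqrtr_ge0.
  by rewrite sqr_sqrtr ?(ltW (divr_gt0 e40 r0))// ler_pdivlMr// mulrC.
(* Clustering only provides a point [y] of the space, so [P] records an index [n] with [y = x n] and
   [B (x n)] small. *)
pose P := [set y : weak_space ip |
  exists n, y = x n /\ r * `|B (x n)| ^+ 2 <= e / 4].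
have xP : (x @ \oo) P by apply: filterS Bxr => n Bn; exists n.
have [y [[n [-> Bn]] /= yc]] :=
  cc P _ xP (@weak_nbhs_halfspace R H ip c (- B c) _ e40).
have y1 := ip_young ip_norm (x n - c) (B (x n)) t0.
have y2 : t * `|x n - c| ^+ 2 <= e / 4 by rewrite -tK ler_wpM2l// ltW.
have y3 := B_coco (x n) c.
have y4 : `|B c| ^+ 2 <= 2 * `|B (x n)| ^+ 2 + 2 * `|B (x n) - B c| ^+ 2.
  by rewrite -{1}[B c](subKr (B (x n))); exact: (normB_sqr_le ip_norm).
have y5 := ler_wpM2l (ltW mu_gt0) y4.
have y6 : ip (x n - c) (B (x n) - B c) =
    ip (x n - c) (B (x n)) + ip (x n) (- B c) - ip c (- B c).
  by rewrite !ipE; ring.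
move: Bn y1; rewrite /r; move: (t^-1) => k Bn y1.
lra.
Qed.

End PenaltyScheme.

(** * Assembly of statements (i), (ii) and (iii) *)

Theorem theorem15
  (R : realType) (H : completeNormedModType R) (ip : {dot H for @idfun R})
  (ip_norm : forall x : H, ip x x = `|x| ^+ 2)
  (A : H -> set H) (D B : H -> H) (eta mu : R) (C : set H)
  (A_max : maximally_monotone ip A)
  (eta_gt0 : 0 < eta) (D_coco : cocoercive ip eta D)
  (mu_gt0 : 0 < mu) (B_coco : cocoercive ip mu B)
  (C_def : C = zer (op_single B)) (C_neq0 : C !=set0)
  (lambda beta : nat -> R)
  (lambda_gt0 : forall n, (1 <= n)%N -> 0 < lambda n)
  (beta_gt0 : forall n, (1 <= n)%N -> 0 < beta n)
  (x : nat -> H)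
  (x_rec : forall n, (1 <= n)%N ->
    resolvent (op_scale (lambda n) A)
      (x n - lambda n *: D (x n) - (lambda n * beta n) *: B (x n)) (x n.+1))
  (hyp1_max : maximally_monotone ip (op_add A (normal_cone ip C)))
  (hyp1_zer :
    zer (op_add (op_add A (op_single D)) (normal_cone ip C)) !=set0)
  (hyp2 : forall p, ran (normal_cone ip C) p ->
    (\sum_(1 <= n <oo) (lambda n * beta n)%:E *
       (ereal_sup [set fitzpatrick ip (op_single B) u ((beta n)^-1 *: p)
                  | u in C]
        - support_fun ip C ((beta n)^-1 *: p)) < +oo)%E)
  (hyp3_l2 : cvg_series1 (fun n => `|lambda n| ^+ 2))
  (hyp3_l1 : ~ cvg_series1 (fun n => `|lambda n|))
  (hyp4 : (limn_esup (fun n => (lambda n * beta n)%:E) < (2 * mu)%:E)%E) :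
  let Z := zer (op_add (op_add A (op_single D)) (normal_cone ip C)) in
  [/\ (* (i) *)
    [/\ forall u, Z u ->
          [/\ cvgn (fun n => `|x n - u|),
              cvg_series1 (fun n => `|x n.+1 - x n| ^+ 2),
              cvg_series1
                (fun n => lambda n * beta n * ip (B (x n)) (x n - u))
            & cvg_series1 (fun n => lambda n * beta n * `|B (x n)| ^+ 2)],
        `|x n.+1 - x n| @[n --> \oo] --> 0
      & (0 < limn_einf (fun n => (lambda n * beta n)%:E))%E ->
          [/\ forall u, Z u -> ip (B (x n)) (x n - u) @[n --> \oo] --> 0,
              `|B (x n)| @[n --> \oo] --> 0
            & weak_cluster ip x `<=` C]],
    (* (ii) *)
    exists2 z, Z z & weak_cvg ip (weighted_mean lambda x) z
    & (* (iii) *)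
    strongly_monotone ip A -> exists2 u, Z = [set u] & x @ \oo --> u].
Proof.
move=> Z.
have l2 : cvgn (series (fun n => lambda n ^+ 2)).
  have -> : (fun n => lambda n ^+ 2) = (fun n => `|lambda n| ^+ 2).
    by apply/funext => n; rewrite real_normK ?num_real.
  exact: (cvg_series1E _).1 hyp3_l2.
have l1 : ~ cvg_series1 lambda.
  move=> cl; apply: hyp3_l1; rewrite /cvg_series1.
  have -> // : (fun n => \sum_(1 <= k < n.+1) `|lambda k|) =
      (fun n => \sum_(1 <= k < n.+1) lambda k).
  apply/funext => n; apply: eq_big_nat => k /andP[k1 _].
  by rewrite gtr0_norm// lambda_gt0.
have [delta [d0 d1 lbd]] : exists delta : R, [/\ 0 < delta, delta < 1 &
    \forall n \near \oo, lambda n * beta n <= 2 * mu * (1 - delta) ^+ 2].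
  have [q q2mu lbq] := limn_esup_lt_near hyp4.
  (* The maximum with [mu] keeps [delta] below 1. By choice of [delta], [r] equals
     [2 * mu * (1 - 2 * delta)], which is at most [2 * mu * (1 - delta) ^+ 2]. *)
  pose r := Num.max q mu.
  have r2mu : r < 2 * mu by rewrite gt_max q2mu/=; lra.
  have mur : mu <= r by rewrite le_max lexx orbT.
  have m4 : 0 < 4 * mu by rewrite mulr_gt0.
  pose delta := (2 * mu - r) / (4 * mu).
  have dE : delta * (4 * mu) = 2 * mu - r by rewrite divfK// gt_eqF.
  have d0 : 0 < delta by rewrite divr_gt0// subr_gt0.
  exists delta; split => //.
    by rewrite ltr_pdivrMr//; lra.
  apply: filterS lbq => n /le_trans; apply.
  apply: (@le_trans _ _ r); first by rewrite le_max lexx.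
  have : 0 <= 2 * mu * delta ^+ 2 by rewrite mulr_ge0 ?sqr_ge0// mulr_ge0// ltW.
  lra.
(* Statements (i) and (ii) use the section with [gamma = 0], that is, plain monotonicity. *)
have A_mono : forall a u b v, A a u -> A b v ->
    0 * `|a - b| ^+ 2 <= ip (a - b) (u - v).
  by move=> a u b v Au Bv; rewrite mul0r; apply: A_max.1.
have fejer := penalty_fejer ip_norm (lexx 0) A_mono eta_gt0 D_coco mu_gt0 B_coco
  C_def lambda_gt0 beta_gt0 x_rec hyp2 l2 d0 d1 lbd.
have [u0 Zu0] := hyp1_zer.
have Bip u : Z u -> forall n, mu * `|B (x n)| ^+ 2 <= ip (B (x n)) (x n - u).
  move=> [_ _ [_ [Cu _] _]] n; have Bu : B u = 0 by move: Cu; rewrite C_def.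
  exact: cocoercive_ip_zero.
split; [split| |].
- move=> u Zu; have [cx cdx cB _ _] := fejer u Zu; split => //.
  + exact: (cvg_series1E _).2 cdx.
  + exact: (cvg_series1E _).2 cB.
  + apply: (cvg_series1E _).2.
    have := is_cvg_series_lin (c := mu^-1) (d := 0) cB cB.
    apply: near_series_le_cvg; near=> n;
      have n1 : (1 <= n)%N by [near: n; exists 1%N].
      by rewrite mulr_ge0 ?sqr_ge0// mulr_ge0// ltW ?lambda_gt0 ?beta_gt0.
    rewrite mul0r addr0 [leRHS]mulrCA; apply: ler_wpM2l.
      by rewrite mulr_ge0// ltW ?lambda_gt0 ?beta_gt0.
    by rewrite [leRHS]mulrC ler_pdivlMr// mulrC; exact: Bip.
- have [_ cdx _ _ _] := fejer u0 Zu0.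
  exact: cvg_sqr_norm0 (cvg_series_cvg_0 cdx).
(* The lower limit is minus the upper limit of the opposite sequence, so [- q] is a positive
   eventual lower bound of [lambda n * beta n]. *)
- rewrite /limn_einf oppe_gt0 => /limn_esup_lt_near[q q0 lbq].
  have Bip0 u : Z u -> ip (B (x n)) (x n - u) @[n --> \oo] --> 0.
    move=> Zu; have [_ _ cB _ _] := fejer u Zu.
    apply: (cvg0_le_scale (_ : 0 < - q) _ _ (cvg_series_cvg_0 cB)).
    - by rewrite oppr_gt0.
    - near=> n; apply: le_trans (Bip u Zu n).
      by rewrite mulr_ge0 ?sqr_ge0// ltW.
    - near=> n; apply: ler_wpM2r; last by rewrite lerNl; near: n.
      by apply: le_trans (Bip u Zu n); rewrite mulr_ge0 ?sqr_ge0// ltW.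
  have B0 : `|B (x n)| @[n --> \oo] --> 0.
    apply: cvg_sqr_norm0; apply: (cvg0_le_scale mu_gt0 _ _ (Bip0 u0 Zu0)).
      by near=> n; exact: sqr_ge0.
    by near=> n; exact: Bip.
  split => //.
  exact: (weak_cluster_zer ip_norm (lexx 0) A_mono eta_gt0 D_coco mu_gt0 B_coco
    C_def lambda_gt0 beta_gt0 x_rec hyp2 l2 d0 d1 lbd Zu0).
- exact: (weighted_mean_weak_cvg ip_norm (lexx 0) A_mono eta_gt0 D_coco mu_gt0
    B_coco C_def lambda_gt0 beta_gt0 x_rec hyp2 l2 d0 d1 lbd l1 hyp1_max Zu0).
- move=> [gamma g0 A_strong].
  (* Convergence to every point of [Z] also gives uniqueness, since limits are unique. *)
  have xu u : Z u -> x @ \oo --> u.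
    by apply: (strongly_monotone_cvg ip_norm (ltW g0) A_strong eta_gt0 D_coco
      mu_gt0 B_coco C_def lambda_gt0 beta_gt0 x_rec hyp2 l2 d0 d1 lbd l1).
  exists u0; last exact: xu.
  apply/seteqP; split => [u Zu|_ ->//] /=.
  exact: (cvg_unique _ (xu _ Zu) (xu _ Zu0)).
Unshelve. all: by end_near.
Qed.
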